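(* Let $m \in \{5,19,35,41,51,65,75,101,129\}$ and let $C$ be an extremal binary doubly even self-dual $[24m,12m,4m+4]$ code. Then the support design $D$ of the minimum weight $4m+4$ of $C$ is not a $7$-design.
   Context: A binary linear code is self-dual if $C=C^\perp$ with respect to the standard inner product, and doubly even if all weights are divisible by $4$. An extremal binary doubly even self-dual $[24m,12m,4m+4]$ code has length $24m$, dimension $12m$ and minimum weight $4m+4$. The support of a codeword $c$ is the set of indices of its nonzero coordinates. The support design of $C$ for weight $w$ has the $24m$ coordinate indices as points and the supports of all codewords of weight $w$ as blocks. A $t$-design is a pair $(X,\mathcal{B})$ of a point set and a collection of $k$-subsets (blocks) such that every $t$-subset of $X$ lies in the same number $\lambda$ of blocks. *)

(* Defs.v *)
From mathcomp Require Import all_boot all_order all_algebra.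

Set Implicit Arguments.
Unset Strict Implicit.
Unset Printing Implicit Defensive.

Import GRing.Theory.
Local Open Scope ring_scope.

Section Codes.
Variable n : nat.
Implicit Types (c x y : 'rV['F_2]_n) (C : {vspace 'rV['F_2]_n}).

Definition supp c : {set 'I_n} := [set i | c 0 i != 0].

Definition wt c : nat := #|supp c|.

Definition dotp x y : 'F_2 := \sum_(i < n) x 0 i * y 0 i.

Definition dual_code C : {set 'rV['F_2]_n} :=
  [set x | [forall y, (y \in C) ==> (dotp x y == 0)]].

Definition self_dual C : Prop := C =i dual_code C.

Definition doubly_even C : Prop := forall c, c \in C -> (4 %| wt c)%N.

Definition min_weight C (d : nat) : Prop :=
  (exists c, [/\ c \in C, c != 0 & wt c = d]) /\
  (forall c, c \in C -> c != 0 -> (d <= wt c)%N).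

(* C is an [n, k, d] code; the length n is carried by the type of C. *)
Definition code_params C (k d : nat) : Prop := \dim C = k /\ min_weight C d.

(* The blocks form a set rather than a multiset: a binary word is determined
   by its support, so no block is repeated. *)
Definition support_design C (w : nat) : {set {set 'I_n}} :=
  [set supp c | c : 'rV['F_2]_n in C & wt c == w].

End Codes.

Definition extremal_doubly_even_self_dual (m : nat)
    (C : {vspace 'rV['F_2]_(24 * m)}) : Prop :=
  [/\ code_params C (12 * m) (4 * m + 4), doubly_even C & self_dual C].

Definition is_design (t : nat) (X : finType) (B : {set {set X}}) : Prop :=
  exists k lam : nat,
    (forall b, b \in B -> #|b| = k) /\
    (forall T : {set X}, #|T| = t -> #|[set b in B | T \subset b]| = lam).

(* Main.v *)
From Stdlib Require Import NArith.
Require Import Defs.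
From mathcomp Require Import all_boot all_order all_algebra.
From mathcomp Require Import finfield.
From mathcomp Require Import ring zify.

(* The shadow of the Assmus-Mattson theorem used here is explicit: for a 5-set
   [T], MacWilliams duality determines the weight enumerator of the codewords
   containing [T] modulo [X ^ (4 m - 1)] (in the variables [1 - X], [1 + X]).
   Multiplying by [(1 - X) (1 + X^2)^2 / (1 - X^4)^(4 m + 1)] and taking the
   coefficient of [X ^ (4 m - 2)] kills, as the residue of an exact form, every
   weight except [4 m + 4] and [24 m], so [T] lies in exactly
   [C(5 m - 2, m - 1)] blocks; for a 7-design this fixes all lambda_i, i <= 6.

   If all weights were divisible by 8, C would be closed under the coordinatewise
   product and its dual would contain a word of weight 2; so some [u] in C has
   weight 4 modulo 8. All blocks meet [u] evenly, so the sum over blocks [b] of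
   the integers [C(#|b :&: u| / 2, 6)] is a rational combination of the
   [C(wt u, i) lambda_i], which is never an integer for the listed [m]. *)

Set Implicit Arguments.
Unset Strict Implicit.
Unset Printing Implicit Defensive.

Import GRing.Theory Num.Theory.

Section RingScope.
Local Open Scope ring_scope.

(** * Residue computations with powers of [(1 - X)^4] and [(1 + X)^4] *)

Section Residue.
Variable R : numFieldType.
Implicit Types (f g q s : {poly R}).

Lemma eq_coef_modXn N f g k : 'X^N %| f - g -> (k < N)%N -> f`_k = g`_k.
Proof.
case/dvdpP=> q fgE ltkN; apply/eqP.
by rewrite -subr_eq0 -coefB fgE coefMXn ltkN.
Qed.

(** Divided by [X^(n+1)], the polynomial is the derivative of [f / X^n], and a derivative has no
    residue. *)
Lemma coef_XderivB f n : ('X * f^`() - n%:R *: f)`_n = 0.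
Proof.
rewrite coefB coefXM coefZ coef_deriv mulr_natl.
by case: n => [|n] /=; rewrite ?mulr0n subrr.
Qed.

Lemma coprimep_Xn_1DX2 N k : coprimep 'X^N ((1 + 'X^2 : {poly R}) ^+ k).
Proof.
apply/coprimep_expl/coprimep_expr.
by rewrite coprimep_sym coprimepX /root !hornerE expr0n addr0 oner_eq0.
Qed.

(* If [q] is the inverse of [(1 + X^2) ^ (e + 2)], this coefficient is, up to a
   nonzero factor, the residue of the derivative of
   [((1 + X)^4 / (X (1 + X^2))) ^ (e + 1)]. *)
Lemma coef_residue_exact e q : 'X^(e.+2) %| (1 + 'X^2) ^+ e.+2 * q - 1 ->
  ((1 - 'X^2) ^+ 3 * (1 + 'X) ^+ 4 ^+ e * q)`_e.+1 = 0.
Proof.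
case/dvdpP=> r qinv; pose u := 1 + 'X^2 : {poly R}.
have du : u^`() = 2%:R * 'X.
  by rewrite derivD derivXn derivC add0r expr1 mulr_natl.
(* [u^(e+1) * h] is [X] times the derivative of [u^(e+2) * q]. That product is 1 modulo [X^(e+2)],
   and [u] is coprime to [X], so [h] vanishes to order [e + 2]. *)
pose h := (2 * e.+2)%:R * 'X^2 * q + 'X * u * q^`().
have h0 : 'X^(e.+2) %| h.
  rewrite -(Gauss_dvdpr _ (coprimep_Xn_1DX2 _ e.+1)) -/u.
  have : 'X * (u ^+ e.+2 * q)^`() = 'X * (1 + r * 'X^(e.+2))^`().
    by rewrite -qinv addrC subrK.
  rewrite derivM derivD derivC derivM derivXn deriv_exp du add0r /= => E.
  have -> : u ^+ e.+1 * h = 'X^(e.+2) * ('X * r^`() + e.+2%:R * r).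
    transitivity ('X * (2%:R * 'X * u ^+ e.+1 *+ e.+2 * q + u ^+ e.+2 * q^`())).
      rewrite (exprS u e.+1) /h natrM -mulr_natl; move: (u ^+ _) => v; ring.
    rewrite E (exprS 'X e.+1) -mulr_natl; move: ('X^(e.+1)) => v; ring.
  by rewrite dvdp_mulIl.
pose t := 1 + 'X : {poly R}.
have dt : t^`() = 1 by rewrite derivD derivX derivC add0r.
pose v := t ^+ 4 ^+ e; pose k : {poly R} := e.+1%:R.
have dv : (t ^+ 4 ^+ e.+1)^`() = 4%:R * k * t ^+ 3 * v.
  rewrite 2!deriv_exp dt mul1r /= -/v -[LHS]mulr_natl -/k.
  by rewrite -[t ^+ 3 *+ 4]mulr_natl; ring.
have k2 : (2 * e.+2)%:R = 2%:R * (k + 1) :> {poly R}.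
  by rewrite natrM /k natr1.
(* Modulo [X^(e+2)], [f] is [(t^4 / u)^(e+1)]. The cube in the statement comes from
   [4 X u - t u - 2 X^2 t = -(1 - X)^3]. *)
pose f := t ^+ 4 ^+ e.+1 * u * q.
have := coef_XderivB f e.+1.
have -> : 'X * f^`() - e.+1%:R *: f = t ^+ 4 ^+ e.+1 * h
   - e.+1%:R *: ((1 - 'X^2) ^+ 3 * v * q).
  rewrite -!mul_polyC polyC_natr -/k.
  rewrite /f 2!derivM du dv (exprS (t ^+ 4) e) -/v.
  rewrite /h k2 /u /t.
  move: v k (q^`()) {dv k2 f} => v' k' q'.
  ring.
rewrite coefB (eq_coef_modXn (g := 0) (N := e.+2)) ?subr0 ?dvdp_mull //.
rewrite coef0 sub0r coefZ => /eqP; rewrite oppr_eq0 mulf_eq0 pnatr_eq0 /=.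
by move/eqP.
Qed.

Let A := (1 - 'X) ^+ 4 : {poly R}.
Let B := (1 + 'X) ^+ 4 : {poly R}.
Let E := 8%:R%:P * (1 + 'X^2) * 'X : {poly R}.

(** Trading [A] for [B] costs a multiple of [X], which lowers the index of the coefficient to be
    read; the three lemmas on quartic coefficients below rest on this exchange. *)
Lemma quartic_subE : B - A = E.
Proof. by rewrite /A /B /E rmorph_nat; ring. Qed.

Lemma coef_mul_quartic_sub f l D : (f * E ^+ l)`_D =
  if (D < l)%N then 0 else 8%:R ^+ l * (f * (1 + 'X^2) ^+ l)`_(D - l).
Proof.
rewrite /E !exprMn !mulrA coefMXn; case: ifP => // _.
by rewrite -mulrA mulrCA -rmorphXn coefCM.
Qed.

Lemma coef0_exp f k : (f ^+ k)`_0 = f`_0 ^+ k.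
Proof. by rewrite -!horner_coef0 horner_exp. Qed.

Lemma coef0_1DX2 k : ((1 + 'X^2 : {poly R}) ^+ k)`_0 = 1.
Proof. by rewrite -horner_coef0 !hornerE expr0n addr0 expr1n. Qed.

(** Induction on [a] through [A = B - E], which preserves [l + a + b]. At [a = 0] the factor [X^l]
    of [E^l] shifts the index to [b + 1], and [q * (1 + X^2)^l] inverts [(1 + X^2)^(b+2)], so
    [coef_residue_exact] applies. *)
Lemma coef_quartic_form D l a b q :
    'X^(D.+1) %| (1 + 'X^2) ^+ D.+1 * q - 1 -> D = (l + a + b).+1 ->
  ((1 - 'X^2) ^+ 3 * q * (A ^+ a * B ^+ b) * E ^+ l)`_D = 0.
Proof.
move=> qinv; elim: a l b => [|a IHa] l b DE; last first.
  set f := (1 - 'X^2) ^+ 3 * q.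
  have -> : f * (A ^+ a.+1 * B ^+ b) * E ^+ l =
      f * (A ^+ a * B ^+ b.+1) * E ^+ l - f * (A ^+ a * B ^+ b) * E ^+ l.+1.
    by rewrite !exprS -quartic_subE; ring.
  by rewrite coefB !IHa ?subr0 //; lia.
rewrite coef_mul_quartic_sub; case: ltnP => // leD.
have -> : (D - l = b.+1)%N by lia.
have -> : (1 - 'X^2) ^+ 3 * q * (A ^+ 0 * B ^+ b) * (1 + 'X^2) ^+ l =
   (1 - 'X^2) ^+ 3 * (1 + 'X) ^+ 4 ^+ b * (q * (1 + 'X^2) ^+ l).
  by rewrite expr0 /B; ring.
rewrite coef_residue_exact ?mulr0 //.
have -> : (1 + 'X^2) ^+ b.+2 * (q * (1 + 'X^2) ^+ l) = (1 + 'X^2) ^+ D.+1 * q.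
  by rewrite mulrCA mulrC -exprD; congr (_ ^+ _ * _); lia.
by apply: dvdp_trans qinv; rewrite dvdp_exp2l //; lia.
Qed.

(** For the minimum weight, where one factor [A] is missing. Replacing a [B] by [E] changes the
    product by a term containing [s * A], whose coefficient is zero; after [D] replacements [E^D]
    contributes [8^D X^D]. *)
Lemma coef_quartic_lead D q s : s`_0 = 1 -> s * A = (1 - 'X^2) ^+ 3 * q ->
    'X^(D.+1) %| (1 + 'X^2) ^+ D.+1 * q - 1 ->
  (s * B ^+ D)`_D = 8%:R ^+ D.
Proof.
move=> s0 sA qinv.
suff sE l : (l <= D)%N -> (s * B ^+ (D - l) * E ^+ l)`_D = (s * B ^+ D)`_D.
  rewrite -(sE D) // subnn expr0 mulr1 coef_mul_quartic_sub ltnn subnn coef0M s0.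
  by rewrite coef0_1DX2 !mulr1.
elim: l => [|l IHl] ltlD; first by rewrite subn0 expr0 mulr1.
rewrite -IHl ?(ltnW ltlD) //.
have -> : (D - l = (D - l.+1).+1)%N by lia.
set b := (D - l.+1)%N.
have -> : s * B ^+ b.+1 * E ^+ l = s * B ^+ b * E ^+ l.+1 +
      (1 - 'X^2) ^+ 3 * q * (A ^+ 0 * B ^+ b) * E ^+ l.
  by rewrite -sA expr0 !exprS -quartic_subE; ring.
by rewrite coefD (coef_quartic_form qinv) ?addr0 // /b; lia.
Qed.

(** For the all-one word. In the expansion of [(B - E)^(D+k)], terms with [l > D] are divisible by
    too high a power of [X], and terms with [l < D] still contain [B^(k+1)] and vanish; [l = D]
    remains, with positive sign because [D] is even. *)
Lemma coef_quartic_trail D k q s : ~~ odd D -> s`_0 = 1 ->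
    s * B ^+ k.+1 = (1 - 'X^2) ^+ 3 * q ->
    'X^(D.+1) %| (1 + 'X^2) ^+ D.+1 * q - 1 ->
  (s * A ^+ (D + k))`_D = 'C(D + k, D)%:R * 8%:R ^+ D.
Proof.
move=> evD s0 sB qinv.
have -> : A = B - E by rewrite -quartic_subE; ring.
rewrite exprBn mulr_sumr coef_sum.
have ltD : (D < (D + k).+1)%N by lia.
rewrite (bigD1 (Ordinal ltD)) //= big1 => [|[l /= ltl] /eqP/val_eqP/= neq].
  rewrite addr0 mulrnAr coefMn -signr_odd (negbTE evD) expr0 mul1r mulrA.
  rewrite coef_mul_quartic_sub ltnn subnn !coef0M s0 coef0_1DX2 mul1r mulr1.
  rewrite -[(B ^+ _)`_0]horner_coef0 !hornerE ?addr0 !expr1n mulr1.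
  by rewrite mulr_natl.
rewrite mulrnAr coefMn -signr_odd !mulrA (mulrC s) -!mulrA [s * _]mulrA.
suff s0l : (s * B ^+ (D + k - l) * E ^+ l)`_D = 0.
  by case: (odd l); rewrite ?mulN1r ?mul1r ?coefN s0l ?oppr0 mul0rn.
have [ltDl|leDl] := ltnP D l; first by rewrite coef_mul_quartic_sub ltDl.
have -> : (D + k - l = k.+1 + (D - l).-1)%N by lia.
rewrite exprD mulrA sB -[B ^+ _]mul1r -(expr0 A).
by rewrite (coef_quartic_form qinv) //; lia.
Qed.
End Residue.

(** * The multiplier series and its effect on each weight *)

Section Gseries.
Variable R : numFieldType.

Lemma dvdp_XnP N (p : {poly R}) :
  (forall i, (i < N)%N -> p`_i = 0) -> 'X^N %| p.
Proof.
move=> p0; rewrite -[p](poly_take_drop N) dvdp_add ?dvdp_mulIr //.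
suff -> : take_poly N p = 0 by rewrite dvdp0.
by apply/polyP=> i; rewrite coef_take_poly coef0; case: ifP => // /p0.
Qed.

(* The binomial series of [1 / (1 - X) ^ k.+1], truncated at degree [N]. *)
Definition inv_1subX_series k N : {poly R} := \poly_(a < N) ('C(a + k, k))%:R.

Lemma inv_1subX_seriesP k N :
  'X^N %| (1 - 'X) ^+ k.+1 * inv_1subX_series k N - 1.
Proof.
elim: k => [|k IHk].
  have -> : inv_1subX_series 0 N = \sum_(a < N) 'X^a.
    rewrite /inv_1subX_series poly_def; apply: eq_bigr => a _.
    by rewrite addn0 bin0 scale1r.
  rewrite expr1 -[1 - 'X]opprB mulNr -subrX1 opprB addrAC subrr sub0r.
  by rewrite dvdpNr.
have -> : (1 - 'X) ^+ k.+2 * inv_1subX_series k.+1 N - 1 =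
  (1 - 'X) ^+ k.+1 * ((1 - 'X) * inv_1subX_series k.+1 N - inv_1subX_series k N)
  + ((1 - 'X) ^+ k.+1 * inv_1subX_series k N - 1) by rewrite (exprS _ k.+1); ring.
apply: dvdp_add => //; apply/dvdp_mull/dvdp_XnP => i ltiN.
rewrite mulrBl mul1r !coefB coefXM !coef_poly ltiN.
case: i ltiN => [|i] ltiN /=; first by rewrite !add0n !binn subr0 subrr.
rewrite (ltnW ltiN) (addSn i k.+1) binS natrD [X in X - _ - _]addrC addrK.
by rewrite (addSnnS i k) subrr.
Qed.

Variable m : nat.
Hypothesis m_gt0 : (0 < m)%N.
Let D := (4 * m - 2)%N.
(* A truncation of [1 / (1 - X^4) ^ (4 m + 1)]. *)
Definition quartic_series : {poly R} := inv_1subX_series (4 * m) m \Po 'X^4.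
Local Notation G := quartic_series.
Let q : {poly R} := (1 - 'X^2) ^+ (4 * m).+1 * (1 + 'X^2) ^+ 2 * G.

Lemma quartic_series0 : G`_0 = 1.
Proof.
by rewrite /quartic_series coef_comp_poly_Xn // coef_poly m_gt0 add0n binn.
Qed.

(** Since [D + 3 = 4 m + 1], the product collapses to [(1 - X^4)^(4 m + 1) * G], which is 1 modulo
    [X^(4 m)]. *)
Lemma quartic_series_inv : 'X^(D.+1) %| (1 + 'X^2) ^+ D.+1 * q - 1.
Proof.
have -> : (1 + 'X^2) ^+ D.+1 * q = (1 - 'X^4) ^+ (4 * m).+1 * G.
  have -> : 1 - 'X^4 = (1 + 'X^2) * (1 - 'X^2) :> {poly R} by ring.
  rewrite exprMn /q.
  have -> : ((4 * m).+1 = D.+1 + 2)%N by rewrite /D; lia.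
  by rewrite !(exprD _ D.+1); move: (D.+1) => d; ring.
apply: (@dvdp_trans _ 'X^(4 * m)); first by rewrite dvdp_exp2l // /D; lia.
have /dvdpP[r rE] := inv_1subX_seriesP (4 * m) m.
have /(congr1 (fun f => f \Po 'X^4)) := rE; rewrite /quartic_series.
rewrite comp_polyB !comp_polyM rmorphXn /= comp_polyB comp_polyX.
rewrite comp_Xn_poly -exprM -[1]/(1%:P) !comp_polyC => ->.
exact: dvdp_mulIr.
Qed.

(* The contribution of a codeword of weight [w]; it is [w - 4] instead of [w - 5]
   because of the factor [1 - X] of the multiplier. *)
Definition weight_coef w : R :=
  ((1 - 'X) ^+ (w - 4) * (1 + 'X) ^+ (24 * m - w) * ((1 + 'X^2) ^+ 2 * G))`_D.

(** The bounds on [j] are exactly those that leave nonnegative powers of [(1 - X)^4] and [(1 + X)^4]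
    once [(1 - X^2)^(4 m + 4)] is split off. *)
Lemma weight_coef_mid j : (m.+2 <= j < 5 * m)%N -> weight_coef (4 * j) = 0.
Proof.
case/andP=> lemj ltjm; rewrite /weight_coef.
rewrite -[RHS](@coef_quartic_form _ D 0 (j - m.+2) (5 * m - j.+1) q
  quartic_series_inv); last by rewrite /D; lia.
rewrite expr0 mulr1 /q; congr (nth 0 (polyseq _) _).
have -> : (4 * j - 4 = 4 * (j - m.+2) + 3 + (4 * m).+1)%N by lia.
have -> : (24 * m - 4 * j = 4 * (5 * m - j.+1) + 3 + (4 * m).+1)%N by lia.
have -> : 1 - 'X^2 = (1 - 'X) * (1 + 'X) :> {poly R} by ring.
by rewrite !exprMn !exprD !expr0; move: (G : {poly R}) => g; ring.
Qed.

Lemma weight_coef_min : weight_coef (4 * m + 4) = 8%:R ^+ D.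
Proof.
pose s := (1 - 'X) ^+ (4 * m) * (1 + 'X) ^+ (4 * m + 4) *
  ((1 + 'X^2) ^+ 2 * G).
rewrite -(coef_quartic_lead (s := s) _ _ quartic_series_inv) /s.
- rewrite /weight_coef -exprM addnK; congr (nth 0 (polyseq _) _).
  have -> : (24 * m - (4 * m + 4) = 4 * m + 4 + 4 * D)%N by rewrite /D; lia.
  by rewrite !exprD !expr0; move: (G : {poly R}) => g; ring.
- rewrite !(coef0M, coef0_exp, coefB, coefD, coefX, coef1) quartic_series0.
  by rewrite subr0 ?addr0 !expr1n !mulr1 expr0n addr0 expr1n mul1r.
rewrite /q.
have -> : 1 - 'X^2 = (1 - 'X) * (1 + 'X) :> {poly R} by ring.
move: (4 * m)%N (G : {poly R}) => N g.
by rewrite !exprMn !(exprD _ N) !(exprS _ N); ring.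
Qed.

Lemma weight_coef_max : weight_coef (24 * m) = 'C(5 * m - 2, D)%:R * 8%:R ^+ D.
Proof.
have -> : (5 * m - 2 = D + m)%N by rewrite /D; lia.
pose s := (1 - 'X) ^+ 4 ^+ m.+1 * ((1 + 'X^2) ^+ 2 * G).
rewrite -(coef_quartic_trail (s := s) _ _ _ quartic_series_inv) /s.
- rewrite /weight_coef subnn expr0 mulr1; congr (nth 0 (polyseq _) _).
  have -> : (24 * m - 4 = 4 * (m.+1 + (D + m)))%N by rewrite /D; lia.
  by rewrite exprM exprD; move: (G : {poly R}) => g; ring.
- by rewrite /D; lia.
- rewrite -exprM !(coef0M, coef0_exp, coefB, coefD, coefX, coef1).
  by rewrite quartic_series0 subr0 !expr1n !mulr1 expr0n addr0 expr1n mul1r.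
rewrite /q.
have -> : 1 - 'X^2 = (1 - 'X) * (1 + 'X) :> {poly R} by ring.
rewrite -!exprM mulnS; move: (4 * m)%N (G : {poly R}) => N g.
by rewrite !exprMn !(exprD _ 4 N) !(exprS _ N); ring.
Qed.

(** The contribution of the constant [#|C|]. As [D] is 2 modulo 4 and [G] is a polynomial in [X^4],
    only the term [2 X^2] of [(1 - X) (1 + X^2)^2] reaches degree [D]. *)
Lemma coef_constant_weight :
  ((1 - 'X) * ((1 + 'X^2) ^+ 2 * G))`_D = 2%:R * 'C(5 * m - 1, 4 * m)%:R.
Proof.
have -> : (1 - 'X) * ((1 + 'X^2) ^+ 2 * G) =
  G - G * 'X^1 + 2%:R%:P * (G * 'X^2) - 2%:R%:P * (G * 'X^3) + G * 'X^4 - G * 'X^5.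
  by rewrite rmorph_nat; move: (G : {poly R}) => g; ring.
rewrite !(coefB, coefD, coefN, coefCM) !coefMXn.
rewrite /quartic_series !coef_comp_poly_Xn //.
have n0 : (4 %| D)%N = false by rewrite /D; lia.
have n1 : (4 %| D - 1)%N = false by rewrite /D; lia.
have n2 : (4 %| D - 2)%N = true by rewrite /D; lia.
have n3 : (D < 3)%N || ~~ (4 %| D - 3)%N by rewrite /D; lia.
have n4 : (D < 4)%N || ~~ (4 %| D - 4)%N by rewrite /D; lia.
have n5 : (D < 5)%N || ~~ (4 %| D - 5)%N by rewrite /D; lia.
have d2 : (D < 2)%N = false by rewrite /D; lia.
have e2 : ((D - 2) %/ 4 = m.-1)%N by rewrite /D; lia.
rewrite n0 n1 n2 d2 e2 !if_same coef_poly prednK // leqnn.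
have -> : (m.-1 + 4 * m = 5 * m - 1)%N by lia.
case: ifP n3 => /= [_ _|_ /negbTE->]; case: ifP n4 => /= [_ _|_ /negbTE->];
  case: ifP n5 => /= [_ _|_ /negbTE->]; ring.
Qed.

End Gseries.

Lemma F2_cases (a : 'F_2) : a = 0 \/ a = 1.
Proof. by case: a => [[|[|//]] ?]; [left|right]; apply/val_inj. Qed.

(** * MacWilliams duality for the codewords containing a given set *)

Section MacWilliams.
Variables (n : nat) (C : {vspace 'rV['F_2]_n}).
Implicit Types x y c : 'rV['F_2]_n.

Lemma dotpC x y : dotp x y = dotp y x.
Proof. by apply: eq_bigr => i _; rewrite mulrC. Qed.

Lemma dotpDl x y z : dotp (x + y) z = dotp x z + dotp y z.
Proof. by rewrite -big_split; apply: eq_bigr => i _; rewrite mxE mulrDl. Qed.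

Lemma dual_codeP x :
  reflect (forall y, y \in C -> dotp x y = 0) (x \in dual_code C).
Proof.
rewrite inE; apply: (iffP forallP) => [H y yC|H y].
  by move/implyP/(_ yC)/eqP: (H y).
by apply/implyP=> /H ->.
Qed.

Section Character.
Variable R : idomainType.
Hypothesis two_neq0 : 2%:R != 0 :> R.

Definition chi (a : 'F_2) : R := if a == 0 then 1 else -1.

Lemma chiD a b : chi (a + b) = chi a * chi b.
Proof.
by case: (F2_cases a) => ->; case: (F2_cases b) => ->;
   rewrite /chi /= ?mul1r ?mulr1 ?mulrNN ?mulr1.
Qed.

Lemma chi_dotp x y : chi (dotp x y) = \prod_i chi (x 0 i * y 0 i).
Proof. by rewrite /dotp (big_morph chi chiD (erefl : chi 0 = 1)). Qed.

Lemma sum_chi_dotp x :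
  \sum_(c in C) chi (dotp c x) = (if x \in dual_code C then #|C|%:R else 0) :> R.
Proof.
case: dual_codeP => [xC|/dual_codeP xNC].
  rewrite -sum1_card natr_sum; apply: eq_bigr => c cC.
  by rewrite dotpC xC.
have [y yC yx] : exists2 y, y \in C & dotp y x = 1.
  move: xNC; rewrite inE negb_forall => /existsP[y].
  rewrite negb_imply => /andP[yC yx]; exists y => //.
  by rewrite dotpC; case: (F2_cases (dotp x y)) yx => ->.
(* Translation by [y] permutes [C] and flips the sign of every term. *)
set S := \sum_(c in C) _; have SN : S = - S.
  rewrite {1}/S (reindex_inj (addIr y)) /= -sumrN.
  apply: eq_big => c; first by rewrite rpredDr.
  by move=> _; rewrite dotpDl chiD yx {2}/chi /= mulrN1.
apply/eqP; move/eqP: SN; rewrite -addr_eq0 -mulr2n -mulr_natl mulf_eq0.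
by rewrite (negbTE two_neq0).
Qed.

(** Poisson summation with a separate function at each coordinate, so that the coordinates in a set
    [T] can be treated differently from the others. *)
Lemma macwilliams (g : 'I_n -> 'F_2 -> R) :
  \sum_(c in C) \prod_i \sum_b g i b * chi (c 0 i * b) =
  #|C|%:R * \sum_(x in dual_code C) \prod_i g i (x 0 i).
Proof.
transitivity (\sum_(c in C) \sum_(x : 'rV['F_2]_n)
                (\prod_i g i (x 0 i)) * chi (dotp c x)).
  apply: eq_bigr => c _; rewrite bigA_distr_bigA /=.
  rewrite (reindex (fun x : 'rV['F_2]_n => [ffun i => x 0 i])) /=.
    apply: eq_bigr => x _; rewrite chi_dotp -big_split /=.
    by apply: eq_bigr => i _; rewrite ffunE.
  exists (fun f => \row_i f i) => f _; first by apply/rowP=> i; rewrite mxE ffunE.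
  by apply/ffunP=> i; rewrite ffunE mxE.
rewrite exchange_big [X in _ * X]big_mkcond mulr_sumr /=; apply: eq_bigr => x _.
by rewrite -mulr_sumr sum_chi_dotp; case: ifP; rewrite ?mulr0 // mulrC.
Qed.
End Character.

Variable R : numFieldType.

Lemma weight_enum_superset (T : {set 'I_n}) d :
    (forall x, x \in dual_code C -> x != 0 -> (d <= wt x)%N) ->
  'X^(d - #|T|) %| \sum_(c in C | T \subset supp c)
     2%:R ^+ #|T| * ((1 - 'X) ^+ (wt c - #|T|) * (1 + 'X) ^+ (n - wt c))
       - (#|C|%:R : {poly R}).
Proof.
move=> dmin.
(* On [T] the transform of the character is 2 at 1 and 0 at 0, which selects the words containing
   [T]; elsewhere it is [1 - X] or [1 + X]. On the dual side the zero word gives [#|C|], and a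
   nonzero word is divisible by [X] to the number of its support points outside [T]. *)
pose g (i : 'I_n) (b : 'F_2) : {poly R} :=
  if i \in T then chi _ b else if b == 0 then 1 else 'X.
have two0 : 2%:R != 0 :> {poly R} by rewrite -polyC_natr polyC_eq0 pnatr_eq0.
have g0 i : g i 0 = 1 by rewrite /g; case: ifP.
have := macwilliams two0 g.
have -> : \sum_(c in C) \prod_i \sum_b g i b * chi _ (c 0 i * b) =
   \sum_(c in C | T \subset supp c)
     2%:R ^+ #|T| * ((1 - 'X) ^+ (wt c - #|T|) * (1 + 'X) ^+ (n - wt c)).
  rewrite big_mkcondr; apply: eq_bigr => c cC.
  have gs i : \sum_b g i b * chi _ (c 0 i * b) =
     if i \in T then (if i \in supp c then 2%:R else 0)
     else (if i \in supp c then 1 - 'X else 1 + 'X).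
    rewrite inE (bigD1 0) // (bigD1 1) //= big1 ?addr0; last first.
      by move=> b; case: (F2_cases b) => ->.
    rewrite mulr0 !mulr1 g0 /g /chi /=.
    by case: ifP => _; case: ifP => _ //=; rewrite ?mulr1 ?mulrN1 ?mulN1r ?opprK ?subrr.
  rewrite (eq_bigr _ (fun i _ => gs i)).
  case: ifP => [/subsetP sTc | /negbT/subsetPn[i iT ic]]; last first.
    by rewrite (bigD1 i) //= iT (negbTE ic) mul0r.
  rewrite (bigID (mem T)) /=; congr (_ * _).
    rewrite (eq_bigr (fun=> 2%:R)) ?prodr_const // => i iT.
    by rewrite iT sTc.
  rewrite (bigID (mem (supp c))) /=; congr (_ * _).
    rewrite (eq_bigr (fun=> 1 - 'X)) => [|i /andP[/negbTE-> ->]] //.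
    rewrite prodr_const; congr (_ ^+ _).
    rewrite /wt -{2}(setIidPr (introT subsetP sTc)) -cardsD.
    by apply: eq_card => i; rewrite !inE unfold_in /= inE.
  rewrite (eq_bigr (fun=> 1 + 'X)) => [|i /andP[/negbTE-> /negbTE->]] //.
  rewrite prodr_const; congr (_ ^+ _).
  have -> : (n - wt c = #|~: supp c|)%N by rewrite cardsCs setCK card_ord.
  apply: eq_card => i; rewrite inE unfold_in /=.
  by case: (boolP (i \in T)) => [/sTc ->|].
move=> ->; rewrite (bigD1 0) /=; last first.
  by apply/dual_codeP=> y _; rewrite /dotp big1 // => i _; rewrite mxE mul0r.
rewrite big1 => [|i _]; last by rewrite mxE g0.
rewrite mulrDr mulr1 addrC addKr dvdp_mull //.
elim/big_ind: _; rewrite ?dvdp0 //; first exact: dvdp_add.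
move=> x /andP[xC x0].
rewrite (bigID (mem (supp x :\: T))) /= dvdp_mulr //.
rewrite (eq_bigr (fun=> 'X)) => [|i]; last first.
  by rewrite !inE /g => /andP[/negbTE-> /negbTE->].
rewrite prodr_const dvdp_exp2l //.
apply: leq_trans (leq_sub2r _ (dmin x xC x0)) _.
by rewrite cardsD leq_sub2l // subset_leq_card // subsetIr.
Qed.
End MacWilliams.

(** * Counting the blocks of an extremal code through a 5-set *)

Lemma supp_inj n : injective (@supp n).
Proof.
move=> x y /setP xy; apply/rowP=> i; move: (xy i); rewrite !inE.
by case: (F2_cases (x 0 i)) => ->; case: (F2_cases (y 0 i)) => ->.
Qed.

Lemma card_support_design_superset n (C : {vspace 'rV['F_2]_n}) w (T : {set 'I_n}) :
  #|[set b in support_design C w | T \subset b]| =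
  #|[set c in C | (T \subset supp c) && (wt c == w)]|.
Proof.
rewrite -(card_imset _ (@supp_inj n)); apply: eq_card => b.
rewrite inE; apply/andP/imsetP => [[/imsetP[c] ]|[c]].
  by rewrite inE => /andP[cC cw] -> Tb; exists c; rewrite // inE cC Tb.
by rewrite inE => /and3P[cC Tc cw] ->; split=> //; apply: imset_f; rewrite inE cC.
Qed.

Lemma dotp1 n (x : 'rV['F_2]_n) : dotp x (const_mx 1) = (wt x)%:R.
Proof.
rewrite /dotp /wt -sum1_card natr_sum [RHS]big_mkcond /=; apply: eq_bigr => i _.
by rewrite inE mxE mulr1; case: (F2_cases (x 0 i)) => ->.
Qed.

Lemma wt_addr1 n (x : 'rV['F_2]_n) : wt (x + const_mx 1) = (n - wt x)%N.
Proof.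
have -> : wt (x + const_mx 1) = #|~: supp x|.
  apply: eq_card => i; rewrite !inE !mxE.
  by case: (F2_cases (x 0 i)) => ->.
by rewrite cardsCs setCK card_ord.
Qed.

Section Extremal.
Variables (m : nat) (C : {vspace 'rV['F_2]_(24 * m)}).
Hypothesis m_gt0 : (0 < m)%N.
Hypothesis extC : extremal_doubly_even_self_dual C.
Implicit Types c : 'rV['F_2]_(24 * m).

Lemma wt_ge c : c \in C -> c != 0 -> (4 * m + 4 <= wt c)%N.
Proof. by case: extC => -[_ [_ H]] _ _; apply: H. Qed.

Lemma wt_dvd4 c : c \in C -> (4 %| wt c)%N.
Proof. by case: extC => _ + _; apply. Qed.

Lemma code_dual : C =i dual_code C. Proof. by case: extC. Qed.

Lemma one_in_code : const_mx 1 \in C.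
Proof.
rewrite code_dual; apply/dual_codeP => y yC; rewrite dotpC dotp1.
have /dvdnP[k ->] := wt_dvd4 yC.
by rewrite natrM [4%:R](_ : _ = 0) ?mulr0 //; apply/val_inj.
Qed.

(** The complement of a codeword is a codeword, so the lower bound on nonzero weights also bounds
    [24 m - wt c]. *)
Lemma wt_cases c : c \in C -> (0 < wt c)%N -> wt c != (4 * m + 4)%N ->
  wt c != (24 * m)%N -> exists2 j, (m.+2 <= j < 5 * m)%N & wt c = (4 * j)%N.
Proof.
move=> cC c_gt0 wmin wmax.
have c0 : c != 0.
  by apply: contraTneq c_gt0 => ->; rewrite -leqNgt leqn0 cards_eq0;
     apply/eqP/setP=> i; rewrite !inE mxE eqxx.
have le_c := wt_ge cC c0.
have le_c1 : wt c = (24 * m)%N \/ (4 * m + 4 <= 24 * m - wt c)%N.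
  have [c1|c1] := eqVneq (c + const_mx 1) 0.
    left; have := wt_addr1 c; rewrite c1 {1}/wt (_ : supp 0 = set0) ?cards0.
      by have := subset_leq_card (subsetT (supp c)); rewrite cardsT card_ord /wt; lia.
    by apply/setP=> i; rewrite !inE mxE eqxx.
  by right; rewrite -wt_addr1; apply: wt_ge c1; rewrite rpredD // one_in_code.
have /dvdnP[j wE] := wt_dvd4 cC.
exists j; move: wE le_c le_c1 wmin wmax; lia.
Qed.

Lemma card_extremal_code : #|C| = (2 ^ (12 * m))%N.
Proof. by case: extC => -[dimC _] _ _; rewrite card_vspace dimC card_Fp. Qed.

Lemma wt_max_unique c : c \in C -> wt c = (24 * m)%N -> c = const_mx 1.
Proof.
move=> cC cmax; apply: supp_inj; apply/eqP; rewrite eqEcard.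
have -> : supp (const_mx 1) = [set: 'I_(24 * m)] by apply/setP=> i; rewrite !inE mxE.
by move: cmax; rewrite subsetT cardsT card_ord /wt => ->; rewrite leqnn.
Qed.

Lemma card_blocks_superset5 (T : {set 'I_(24 * m)}) : #|T| = 5 ->
  #|[set b in support_design C (4 * m + 4) | T \subset b]| = 'C(5 * m - 2, m - 1).
Proof.
move=> T5; rewrite card_support_design_superset; set cnt := #|_|.
pose D := (4 * m - 2)%N.
have dmin x : x \in dual_code C -> x != 0 -> (4 * m + 4 <= wt x)%N.
  by rewrite -code_dual; apply: wt_ge.
have /(dvdp_mulr ((1 - 'X) * ((1 + 'X^2) ^+ 2 * quartic_series rat m))) :=
  weight_enum_superset rat T dmin.
(* [D] is the last degree at which duality determines the enumerator. *)
have ltD : (D < 4 * m + 4 - 5)%N by rewrite /D; lia.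
rewrite T5 mulrBl => /eq_coef_modXn/(_ ltD).
rewrite mulr_suml coef_sum -polyC_natr coefCM coef_constant_weight // => E.
have {}E : 32%:R * (\sum_(c in C | T \subset supp c) weight_coef rat m (wt c)) =
   #|C|%:R * (2%:R * 'C(5 * m - 1, 4 * m)%:R).
  rewrite -E mulr_sumr; apply: eq_bigr => c /andP[_ /subset_leq_card].
  rewrite T5 -/(wt c) => w5.
  have -> : 2%:R ^+ 5 = 32%:R%:P :> {poly rat} by rewrite rmorph_nat -natrX.
  rewrite -!mulrA coefCM /weight_coef; congr (_ * nth 0 (polyseq _) _).
  have -> : (wt c - 4 = (wt c - 5).+1)%N by lia.
  by rewrite exprS -!mulrA 2!(mulrCA _ (1 - 'X)).
have TT : T \subset supp (const_mx 1).
  by apply/subsetP=> i _; rewrite !inE mxE.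
have wt1 : wt (const_mx 1 : 'rV['F_2]_(24 * m)) = (24 * m)%N.
  by rewrite -[const_mx 1]add0r wt_addr1 /wt (_ : supp 0 = set0) ?cards0 ?subn0 //;
     apply/setP=> i; rewrite !inE mxE eqxx.
move: E; rewrite (bigD1 (const_mx 1)) /= ?one_in_code ?TT //.
rewrite (bigID (fun c => wt c == (4 * m + 4)%N)) /= [X in _ + (_ + X)]big1; last first.
  move=> c /andP[/andP[/andP[cC Tc] c1] wmin].
  have [//|||j jb ->] := wt_cases cC; last exact: weight_coef_mid jb.
  - by have := subset_leq_card Tc; rewrite T5 /wt; lia.
  - by [].
  by apply: contraNneq c1 => /(wt_max_unique cC) ->.
rewrite (eq_bigr (fun=> 8%:R ^+ D)) => [|c /andP[_ /eqP->]];
  last exact: weight_coef_min.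
rewrite wt1 weight_coef_max // addr0 sumr_const -/D.
rewrite (_ : #|_| = cnt); last first.
  rewrite /cnt; apply: eq_card => c; rewrite !inE unfold_in /= -!andbA.
  congr (_ && (_ && _)).
  rewrite andb_idl // => /eqP wc; apply/eqP=> c1.
  by move: wc; rewrite c1 wt1; lia.
rewrite card_extremal_code => E.
(* Doubling the equation lets both sides share the factor [64 * 8^D = 2^(12 m)]. *)
have {}E : (64 * 8 ^ D * ('C(5 * m - 2, D) + cnt) =
     64 * 8 ^ D * (4 * 'C(5 * m - 1, 4 * m)))%N.
  have -> : (64 * 8 ^ D * (4 * 'C(5 * m - 1, 4 * m)) =
     2 * (2 ^ (12 * m) * (2 * 'C(5 * m - 1, 4 * m))))%N.
    rewrite (_ : 2 ^ (12 * m) = 64 * 8 ^ D)%N; first by lia.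
    rewrite (_ : 64 = 8 ^ 2)%N // -expnD (_ : 2 + D = 4 * m)%N; last by rewrite /D; lia.
    by rewrite (_ : 8 = 2 ^ 3)%N // -expnM mulnA.
  apply/eqP; rewrite -(eqr_nat rat) [X in _ == X]natrM (natrM _ (2 ^ _)).
  rewrite (natrM _ 2 'C(_, _)) -E.
  by apply/eqP; rewrite -mulr_natr !natrM natrD natrX; ring.
move/eqP: E; rewrite eqn_pmul2l ?muln_gt0 ?expn_gt0 // => /eqP E.
(* With this, the count becomes a difference of two binomials to which Pascal's rule applies. *)
have binE : (4 * 'C(5 * m - 1, 4 * m) = 'C(5 * m - 1, 4 * m - 1))%N.
  have := mul_bin_left (5 * m - 1) (4 * m - 1).
  rewrite (_ : (4 * m - 1).+1 = m * 4)%N; last by lia.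
  rewrite (_ : 5 * m - 1 - (4 * m - 1) = m)%N; last by lia.
  by rewrite -mulnA (mulnC m 4) => /eqP; rewrite eqn_pmul2l // => /eqP.
have pascal : ('C(5 * m - 1, 4 * m - 1) =
    'C(5 * m - 2, 4 * m - 1) + 'C(5 * m - 2, D))%N.
  rewrite (_ : 5 * m - 1 = (5 * m - 2).+1)%N; last by lia.
  by rewrite (_ : 4 * m - 1 = D.+1)%N ?binS // /D; lia.
have -> : 'C(5 * m - 2, m - 1) = 'C(5 * m - 2, 4 * m - 1).
  by rewrite -bin_sub; [congr 'C(_, _)|]; lia.
by move: E; rewrite binE pascal; lia.
Qed.
End Extremal.

(** * Self-dual codes with all weights divisible by 8 *)

Section WeightMod8.

Lemma odd_natF2 k : (k%:R == 0 :> 'F_2) = ~~ odd k.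
Proof. by rewrite -(dvdn_pcharf (pchar_Fp (isT : prime 2))) dvdn2. Qed.

Variable n : nat.
Implicit Types x y z : 'rV['F_2]_n.

Definition pwmul x y : 'rV['F_2]_n := \row_i (x 0 i * y 0 i).

Lemma supp_pwmul x y : supp (pwmul x y) = supp x :&: supp y.
Proof. by apply/setP=> i; rewrite !inE mxE mulf_eq0 negb_or. Qed.

Lemma dotp_wt x y : dotp x y = (wt (pwmul x y))%:R.
Proof. by rewrite -dotp1; apply: eq_bigr => i _; rewrite !mxE mulr1. Qed.

Lemma wt_add x y : (wt (x + y) + 2 * wt (pwmul x y) = wt x + wt y)%N.
Proof.
rewrite /wt -!sum1_card !(big_mkcond (fun i => i \in _)) /= big_distrr -!big_split /=.
apply: eq_bigr => i _; rewrite !inE !mxE.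
by case: (F2_cases (x 0 i)) => ->; case: (F2_cases (y 0 i)) => ->.
Qed.

Lemma pwmulDl x y z : pwmul (x + y) z = pwmul x z + pwmul y z.
Proof. by apply/rowP=> i; rewrite !mxE mulrDl. Qed.

Variable C : {vspace 'rV['F_2]_n}.
Hypothesis selfC : self_dual C.
Hypothesis div8 : forall c, c \in C -> (8 %| wt c)%N.

(* By inclusion-exclusion, supports of two codewords meet in a multiple of 4
   points and supports of three in an even number of points. *)
Lemma pwmul_closed x y : x \in C -> y \in C -> pwmul x y \in C.
Proof.
have div4 (u v : 'rV['F_2]_n) : u \in C -> v \in C -> (4 %| wt (pwmul u v))%N.
  move=> uC vC; have duv : (8 %| wt (u + v))%N by rewrite div8 ?rpredD.
  have := wt_add u v; have := div8 uC; have := div8 vC; move: duv; lia.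
move=> xC yC; rewrite selfC; apply/dual_codeP=> z zC.
rewrite dotp_wt; apply/eqP; rewrite odd_natF2.
have := wt_add (pwmul x z) (pwmul y z); rewrite -pwmulDl.
have -> : wt (pwmul (pwmul x z) (pwmul y z)) = wt (pwmul (pwmul x y) z).
  by rewrite /wt !supp_pwmul; congr #|pred_of_set _|; apply/setP=> i;
     rewrite !inE; do 3!case: (_ == _).
have dxy : (4 %| wt (pwmul (x + y) z))%N by rewrite div4 ?rpredD.
have := div4 _ _ xC zC; have := div4 _ _ yC zC; lia.
Qed.

(* The coordinatewise product with a minimum weight word [x] is [0] or [x], so
   codewords are constant on the support of [x]. *)
Lemma min_weight_le2 d : min_weight C d -> (d <= 2)%N.
Proof.
case=> -[x [xC x0 wx]] dmin; rewrite leqNgt; apply/negP=> d_gt2.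
have const y i j : y \in C -> i \in supp x -> j \in supp x -> y 0 i = y 0 j.
  move=> yC ix jx.
  have sub : supp (pwmul x y) \subset supp x by rewrite supp_pwmul subsetIl.
  have [p0|p0] := eqVneq (pwmul x y) 0.
    have out k : k \in supp x -> y 0 k = 0.
      rewrite inE => /negbTE xk; apply/eqP.
      by move/rowP/(_ k)/eqP: p0; rewrite !mxE mulf_eq0 xk.
    by rewrite !out.
  have /eqP E : supp (pwmul x y) == supp x.
    by rewrite eqEcard sub /= -/(wt x) wx; apply: dmin p0; apply: pwmul_closed.
  move: ix jx; rewrite -E supp_pwmul !inE => /andP[_ iy] /andP[_ jy].
  by case: (F2_cases (y 0 i)) iy => ->; case: (F2_cases (y 0 j)) jy => ->.
have [i [j [ix jx ij]]] : exists i j, [/\ i \in supp x, j \in supp x & i != j].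
  have /card_gt1P[i [j [ix jx ij]]] : (1 < #|supp x|)%N by rewrite -/(wt x) wx ltnW.
  by exists i, j.
pose e : 'rV['F_2]_n := \row_k ((k == i) || (k == j))%:R.
have se : supp e = [set i; j].
  by apply/setP=> k; rewrite !inE mxE; case: (_ || _).
have eC : e \in C.
  rewrite selfC; apply/dual_codeP=> y yC.
  rewrite dotpC dotp_wt; apply/eqP; rewrite odd_natF2 /wt supp_pwmul se.
  have [iy|iy] := boolP (i \in supp y).
    rewrite (setIidPr _) ?cards2 ?ij // subUset !sub1set iy /=.
    by move: iy; rewrite !inE (const y i j).
  rewrite (_ : _ :&: _ = set0) ?cards0 //; apply/eqP; rewrite setI_eq0.
  rewrite disjoint_sym disjoints_subset subUset !sub1set !inE.
  by move: iy; rewrite !inE (const y i j) // => ->.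
have e0 : e != 0.
  by apply/eqP=> /rowP/(_ i)/eqP; rewrite !mxE eqxx.
by have := dmin e eC e0; rewrite /wt se cards2 ij leqNgt d_gt2.
Qed.
End WeightMod8.

(** * Binomial coefficients as polynomials *)

Lemma natr_ffact (R : comNzRingType) n k :
  (n ^_ k)%N%:R = \prod_(a < k) (n%:R - a%:R) :> R.
Proof.
elim: k => [|k IHk]; first by rewrite big_ord0.
rewrite ffactnSr natrM IHk big_ord_recr /=.
have [lekn|ltnk] := leqP k n; first by rewrite natrB.
by rewrite -IHk ffact_small // !mul0r.
Qed.

(** Turns [bin_double6] into a polynomial identity that [field] can decide. *)
Lemma natr_bin (R : numFieldType) n k :
  ('C(n, k))%:R = (\prod_(a < k) (n%:R - a%:R)) / (k`!)%:R :> R.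
Proof.
by rewrite -natr_ffact -bin_ffact natrM mulfK // pnatr_eq0 -lt0n fact_gt0.
Qed.

End RingScope.

(** * Double counting in designs *)

Section DesignCounting.
Variables (X : finType) (B : {set {set X}}).

Definition cover_num (S : {set X}) := #|[set b in B | S \subset b]|.

Lemma cover_numE S : cover_num S = \sum_(b in B) (S \subset b).
Proof.
rewrite /cover_num -sum1_card big_mkcond [RHS]big_mkcond /=.
by apply: eq_bigr => b _; rewrite inE; case: (b \in B); case: (S \subset b).
Qed.

(** Count the pairs of a point [x] outside [S] and a block containing [x |: S]. *)
Lemma cover_num_down t k lam : (forall b, b \in B -> #|b| = k) ->
    (forall T : {set X}, #|T| = t.+1 -> cover_num T = lam) ->
  forall S : {set X}, #|S| = t -> cover_num S * (k - t) = (#|X| - t) * lam.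
Proof.
move=> Bk Blam S St.
transitivity (\sum_(x in ~: S) cover_num (x |: S)); last first.
  rewrite (eq_bigr (fun=> lam)) => [|x]; last first.
    by rewrite inE => xS; apply: Blam; rewrite cardsU1 xS St.
  by rewrite sum_nat_const; congr (_ * _); rewrite cardsCs setCK St.
under eq_bigr do rewrite cover_numE.
rewrite exchange_big cover_numE big_distrl /=; apply: eq_bigr => b bB.
have [Sb|Sb] := boolP (S \subset b); last first.
  rewrite mul0n big1 // => x _; apply/eqP; rewrite eqb0.
  by apply: contra Sb; apply: subset_trans; apply: subsetUr.
rewrite mul1n -(Bk b bB) -St -[in LHS](setIidPr Sb) -cardsD -sum1_card big_mkcond.
rewrite [RHS]big_mkcond; apply: eq_bigr => x _.
by rewrite !inE subUset sub1set Sb andbT; case: (x \in S); case: (x \in b).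
Qed.

(** Count the pairs of a [t]-subset [T] of [u] and a block containing [T]. *)
Lemma sum_bin_meet t lam (u : {set X}) :
    (forall T : {set X}, #|T| = t -> cover_num T = lam) ->
  \sum_(b in B) 'C(#|b :&: u|, t) = 'C(#|u|, t) * lam.
Proof.
move=> Blam.
rewrite -cards_draws -sum_nat_const.
transitivity (\sum_(T in [set T : {set X} | T \subset u & #|T| == t])
                cover_num T); last first.
  by apply: eq_bigr => T; rewrite inE => /andP[_ /eqP/Blam].
under [RHS]eq_bigr do rewrite cover_numE.
rewrite exchange_big /=; apply: eq_bigr => b bB.
rewrite -cards_draws -sum1_card big_mkcond [RHS]big_mkcond; apply: eq_bigr => T _.
rewrite !inE subsetI; case: (T \subset u); case: (T \subset b) => //=.
by case: ifP.
Qed.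

End DesignCounting.

(* The expansion of [C(x / 2, 6)] in the basis [C(x, l)], denominators cleared and
   negative terms moved to the left. *)
Lemma bin_double6 i :
  1024 * 'C(i, 6) + 21 * 'C(i.*2, 1) + 56 * 'C(i.*2, 3) + 40 * 'C(i.*2, 5) =
  42 * 'C(i.*2, 2) + 56 * 'C(i.*2, 4) + 16 * 'C(i.*2, 6).
Proof.
apply/eqP; rewrite -(@eqr_nat rat) !(natrD, natrM) !natr_bin -muln2 natrM.
rewrite !big_ord_recr !big_ord0 /= -[1`!]/1 -[2`!]/2 -[3`!]/6 -[4`!]/24 -[5`!]/120.
by rewrite -[6`!]/720; apply/eqP; field.
Qed.

(** * The numerical check in binary arithmetic *)

(** Binary numbers, because the binomials reach hundreds of bits, out of range for computing with
    unary [nat]. *)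
Fixpoint ffactN (n : N) (k : nat) : N :=
  if k is k'.+1 then (n * ffactN (N.pred n) k')%num else 1%num.

Lemma ffactNE n k : N.of_nat (n ^_ k) = ffactN (N.of_nat n) k.
Proof.
elim: k n => [|k IHk] n; first by rewrite ffactn0.
by rewrite ffactnS Nat2N.inj_mul IHk /= Nat2N.inj_pred.
Qed.

Definition binN (n : N) (k : nat) : N :=
  N.div (ffactN n k) (ffactN (N.of_nat k) k).

Lemma binNE n k : N.of_nat 'C(n, k) = binN (N.of_nat n) k.
Proof.
rewrite /binN -!ffactNE ffactnn -bin_ffact Nat2N.inj_mul N.div_mul //.
by have := fact_gt0 k; lia.
Qed.

(** These solve the recurrence of [cover_num_down] for the next and for the previous lambda; the
    divisions are exact whenever the recurrence holds in integers. *)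
Definition lambdaN_up (n k i l : N) : N := N.div (l * (k - i)) (n - i).
Definition lambdaN_down (n k i l : N) : N := N.div ((n - i) * l) (k - i).

(* The identity [bin_double6], summed over the blocks, fails modulo 1024 for every
   weight [w = 8 r + 4 <= 24 m] of the word [u]. *)
Definition meet_check (m : nat) : bool :=
  let n := N.of_nat (24 * m) in let k := N.of_nat (4 * m + 4) in
  let l5 := binN (N.of_nat (5 * m - 2)) (m - 1) in
  let l6 := lambdaN_up n k 5 l5 in
  let l4 := lambdaN_down n k 4 l5 in
  let l3 := lambdaN_down n k 3 l4 in
  let l2 := lambdaN_down n k 2 l3 in
  let l1 := lambdaN_down n k 1 l2 in
  let r1 := N.modulo l1 1024 in let r2 := N.modulo l2 1024 in
  let r3 := N.modulo l3 1024 in let r4 := N.modulo l4 1024 in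
  let r5 := N.modulo l5 1024 in let r6 := N.modulo l6 1024 in
  all (fun r => let w := N.of_nat (8 * r + 4) in
    ~~ N.eqb
     (N.modulo (21 * (binN w 1 * r1) + 56 * (binN w 3 * r3) +
                40 * (binN w 5 * r5)) 1024)
     (N.modulo (42 * (binN w 2 * r2) + 56 * (binN w 4 * r4) +
                16 * (binN w 6 * r6)) 1024))%num
   (iota 0 (3 * m)).

Lemma meet_checkT : all meet_check [:: 5; 19; 35; 41; 51; 65; 75; 101; 129].
Proof. by vm_compute. Qed.

(** Passes from the residues [r1] to [r6] of [meet_check] back to the lambdas themselves. *)
Lemma modN_lin3 M a1 b1 c1 a2 b2 c2 a3 b3 c3 :
  N.modulo (a1 * (b1 * N.modulo c1 M) + a2 * (b2 * N.modulo c2 M) +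
            a3 * (b3 * N.modulo c3 M))%num M =
  N.modulo (a1 * (b1 * c1) + a2 * (b2 * c2) + a3 * (b3 * c3))%num M.
Proof.
rewrite {2}(N.div_mod' c1 M) {2}(N.div_mod' c2 M) {2}(N.div_mod' c3 M).
rewrite -(N.Div0.mod_add _ (a1 * b1 * (c1 / M) + a2 * b2 * (c2 / M) +
                           a3 * b3 * (c3 / M))%num).
by congr N.modulo; lia.
Qed.

Lemma meet_check_contra m r l1 l2 l3 l4 l5 l6 s :
    meet_check m -> (r < 3 * m)%N -> l5 = 'C(5 * m - 2, m - 1) ->
    l1 * (4 * m + 4 - 1) = (24 * m - 1) * l2 ->
    l2 * (4 * m + 4 - 2) = (24 * m - 2) * l3 ->
    l3 * (4 * m + 4 - 3) = (24 * m - 3) * l4 ->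
    l4 * (4 * m + 4 - 4) = (24 * m - 4) * l5 ->
    l5 * (4 * m + 4 - 5) = (24 * m - 5) * l6 ->
  let w := 8 * r + 4 in
  1024 * s + 21 * ('C(w, 1) * l1) + 56 * ('C(w, 3) * l3)
    + 40 * ('C(w, 5) * l5) =
    42 * ('C(w, 2) * l2) + 56 * ('C(w, 4) * l4) + 16 * ('C(w, 6) * l6) -> False.
Proof.
move=> chk ltr l5E E1 E2 E3 E4 E5 w Es.
have down i l l' : 0 < i < 5 -> l * (4 * m + 4 - i) = (24 * m - i) * l' ->
    lambdaN_down (N.of_nat (24 * m)) (N.of_nat (4 * m + 4)) (N.of_nat i)
      (N.of_nat l') = N.of_nat l.
  move=> i5 E; rewrite /lambdaN_down -!Nat2N.inj_sub -Nat2N.inj_mul.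
  rewrite (_ : Nat.mul _ _ = l * (4 * m + 4 - i)) // Nat2N.inj_mul N.div_mul //.
  by lia.
have l6E : lambdaN_up (N.of_nat (24 * m)) (N.of_nat (4 * m + 4)) 5
    (N.of_nat l5) = N.of_nat l6.
  rewrite /lambdaN_up -[5%num]/(N.of_nat 5) -!Nat2N.inj_sub -Nat2N.inj_mul.
  rewrite (_ : Nat.mul _ _ = l6 * (24 * m - 5)); last by rewrite [RHS]mulnC -E5.
  by rewrite Nat2N.inj_mul N.div_mul //; lia.
move: chk; rewrite /meet_check.
rewrite -binNE -l5E l6E (down 4 _ _ _ E4) // (down 3 _ _ _ E3) //.
rewrite (down 2 _ _ _ E2) // (down 1 _ _ _ E1) //.
move/allP/(_ r); rewrite mem_iota leq0n add0n => /(_ ltr)/negP; apply.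
rewrite -!binNE -/w; apply/N.eqb_spec.
(* The unknown sum [s] enters only as [1024 * s], so its integrality alone gives the congruence
   refuted by the check. *)
rewrite !modN_lin3 -(N.Div0.mod_add _ (N.of_nat s)); congr N.modulo.
by move: Es; clear; lia.
Qed.

(** * The contradiction for a 7-design *)

Lemma cover_num_const_down (X : finType) (B : {set {set X}}) k t :
    (forall b, b \in B -> #|b| = k) -> t < k ->
    (exists lam, forall T : {set X}, #|T| = t.+1 -> cover_num B T = lam) ->
  exists lam, forall S : {set X}, #|S| = t -> cover_num B S = lam.
Proof.
move=> Bk ltk [lam lamP]; exists ((#|X| - t) * lam %/ (k - t)) => S St.
by rewrite -(cover_num_down Bk lamP St) mulnK // subn_gt0.
Qed.

Lemma exists_card (X : finType) t : t <= #|X| -> exists S : {set X}, #|S| = t.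
Proof.
move=> let_; have : 0 < #|[set S : {set X} | S \subset [set: X] & #|S| == t]|.
  by rewrite cards_draws cardsT bin_gt0.
by case/card_gt0P=> S; rewrite inE => /andP[_ /eqP]; exists S.
Qed.

Section NoDesign.
Variables (m : nat) (C : {vspace 'rV['F_2]_(24 * m)}).
Hypothesis m_gt0 : 0 < m.
Hypothesis extC : extremal_doubly_even_self_dual C.
Local Notation B := (support_design C (4 * m + 4)).

Lemma card_block b : b \in B -> #|b| = 4 * m + 4.
Proof. by case/imsetP=> c; rewrite inE => /andP[_ /eqP <-] ->. Qed.

Lemma meet_even b u : b \in B -> u \in C ->
  #|b :&: supp u| = #|b :&: supp u|./2.*2.
Proof.
case/imsetP=> c; rewrite inE => /andP[cC _] -> uC.
have /eqP := dual_codeP _ _ (etrans (esym (code_dual extC c)) cC) u uC.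
by rewrite dotp_wt odd_natF2 /wt supp_pwmul => ev; rewrite even_halfK.
Qed.

Lemma exists_weight4mod8 : exists2 u, u \in C & exists r, wt u = 8 * r + 4.
Proof.
have [/existsP[u /andP[uC u8]]|/existsPn no] :=
  boolP [exists u, (u \in C) && ~~ (8 %| wt u)].
  exists u => //; have := wt_dvd4 extC uC => u4.
  by exists (wt u %/ 8); move: u8 u4; lia.
have div8 c : c \in C -> 8 %| wt c.
  by move=> cC; move: (no c); rewrite cC /= negbK.
case: (extC) => -[_ minw] _ selfC.
by have := min_weight_le2 selfC div8 minw; lia.
Qed.

Lemma extremal_not_7design : meet_check m -> ~ is_design 7 B.
Proof.
move=> chk [k [lam [_ lam7]]].
have ex7 : exists lam, forall T : {set 'I_(24 * m)},
  #|T| = 7 -> cover_num B T = lam by exists lam.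
have down t := @cover_num_const_down _ _ _ t card_block.
have ex6 := down 6 (ltac:(lia)) ex7.
have ex5 := down 5 (ltac:(lia)) ex6.
have ex4 := down 4 (ltac:(lia)) ex5.
have ex3 := down 3 (ltac:(lia)) ex4.
have ex2 := down 2 (ltac:(lia)) ex3.
have ex1 := down 1 (ltac:(lia)) ex2.
case: ex1 ex2 ex3 ex4 ex5 ex6 => l1 L1 [l2 L2] [l3 L3] [l4 L4] [l5 L5] [l6 L6].
have rel t l l' : t < 24 * m ->
    (forall S : {set 'I_(24 * m)}, #|S| = t -> cover_num B S = l) ->
    (forall S : {set 'I_(24 * m)}, #|S| = t.+1 -> cover_num B S = l') ->
    l * (4 * m + 4 - t) = (24 * m - t) * l'.
  move=> ltn Ll Ll'; have [|S St] := @exists_card 'I_(24 * m) t.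
    by rewrite card_ord ltnW.
  by rewrite -(Ll S St) (cover_num_down card_block Ll' St) card_ord.
have [u uC [r wE]] := exists_weight4mod8.
have wle : wt u <= 24 * m by rewrite (leq_trans (max_card _)) ?card_ord.
have l5E : l5 = 'C(5 * m - 2, m - 1).
  have [|T T5] := @exists_card 'I_(24 * m) 5; first by rewrite card_ord; lia.
  by rewrite -(card_blocks_superset5 m_gt0 extC T5) -(L5 T T5).
have meet t l := @sum_bin_meet _ B t l (supp u).
apply: (@meet_check_contra m r l1 l2 l3 l4 l5 l6
  (\sum_(b in B) 'C(#|b :&: supp u|./2, 6))) => //;
  try by apply: rel => //; lia.
  lia.
(* Each product of a binomial of [wt u] and a lambda becomes a sum over blocks again, so the goal is
   [bin_double6] block by block, with [i] half the size of the meet. *)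
rewrite -wE /wt -(meet _ _ L1) -(meet _ _ L2) -(meet _ _ L3) -(meet _ _ L4).
rewrite -(meet _ _ L5) -(meet _ _ L6).
rewrite !big_distrr -!big_split /=; apply: eq_bigr => b bB.
by rewrite (meet_even bB uC) doubleK; apply: bin_double6.
Qed.
End NoDesign.

Theorem theorem5 (m : nat) (C : {vspace 'rV['F_2]_(24 * m)}) :
  m \in [:: 5; 19; 35; 41; 51; 65; 75; 101; 129] ->
  extremal_doubly_even_self_dual C ->
  ~ is_design 7 (support_design C (4 * m + 4)).
Proof.
move=> mS extC; apply: extremal_not_7design => //; last exact: (allP meet_checkT).
by move: mS; rewrite !inE; case: (m).
Qed.
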